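(* Let $k$ be a finite field of order $q$ and let $n\ge 1$. The set $\{x^{i+q^nj}\mid q^n>i>j\ge 0\}$, which contains $\binom{q^n}{2}$ monomials, is a $k$-linear basis for a $k$-linear subspace $Y_n$ of $k[x]_0$ that is complementary to $W_n$; that is, $k[x]_0=Y_n\oplus W_n$ as $k$-vector spaces.
   Context: $k[x]_0$ denotes the free associative $k$-algebra without unit on one generator $x$ (polynomials in $x$ over $k$ with zero constant term). A $T$-space of $k[x]_0$ is a $k$-linear subspace invariant under all $k$-algebra endomorphisms of $k[x]_0$. $W_n$ is the smallest $T$-space of $k[x]_0$ containing $x+x^{q^n}$ and $x^{q^n+1}$. In the set, $i$ and $j$ range over integers. *)

(* Defs.v *)
From HB Require Import structures.
From mathcomp Require Import all_boot all_algebra.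
From mathcomp Require Import mathcomp_extra boolp classical_sets functions cardinality.

Set Implicit Arguments.
Unset Strict Implicit.
Unset Printing Implicit Defensive.

Import GRing.Theory.

Local Open Scope classical_set_scope.
Local Open Scope ring_scope.

Section LinearAlgebra.
Variables (k : fieldType) (V : lmodType k).
Implicit Types B Y W : set V.

(* Subspaces are Prop-valued, since V may be infinite-dimensional. *)
Definition subspace Y : Prop := GRing.submod_closed (mem Y).

Definition lin_span B : set V := smallest subspace B.

(* B may be infinite: s ranges over the finite subfamilies of B. *)
Definition lin_indep B : Prop :=
  forall (s : seq V) (c : V -> k), uniq s -> [set` s] `<=` B ->
    \sum_(v <- s) c v *: v = 0 -> {in s, forall v, c v = 0}.

Definition is_basis B Y : Prop := lin_indep B /\ lin_span B = Y.

Definition is_direct_sum Y W : Prop :=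
  [/\ subspace Y, subspace W,
      [set y + w | y in Y & w in W] = [set: V] & Y `&` W = [set 0]].

End LinearAlgebra.

Section NonunitalPolynomials.
Variable k : fieldType.

Definition zero_const : {pred {poly k}} := [pred p : {poly k} | p`_0 == 0].

Fact zero_const_submod : GRing.submod_closed zero_const.
Proof.
split=> [|a p r]; rewrite !inE ?coef0 //.
by move=> /eqP p0 /eqP r0; rewrite coefD coefZ p0 r0 mulr0 addr0.
Qed.

HB.instance Definition _ :=
  GRing.isSubmodClosed.Build k {poly k} zero_const zero_const_submod.

(* The nonunital algebra k[x]_0, as a k-module; its product is [kx0_mul], since
   a ring structure would require a unit. *)
Record kx0 := Kx0 { kx0_val :> {poly k}; _ : kx0_val \in zero_const }.

HB.instance Definition _ := [isSub for kx0_val].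
HB.instance Definition _ := [Choice of kx0 by <:].
HB.instance Definition _ := [SubChoice_isSubLmodule of kx0 by <:].

Fact kx0_mul_subproof (p r : kx0) : (p : {poly k}) * r \in zero_const.
Proof. by move: (valP p); rewrite !inE coef0M => /eqP ->; rewrite mul0r. Qed.

Definition kx0_mul (p r : kx0) : kx0 := Kx0 (kx0_mul_subproof p r).

Definition kx0_endomorphism (phi : kx0 -> kx0) : Prop :=
  linear phi /\ {morph phi : p r / kx0_mul p r}.

Definition T_space (S : set kx0) : Prop :=
  subspace S /\
  forall phi, kx0_endomorphism phi -> forall p, S p -> S (phi p).

End NonunitalPolynomials.

Section TheSpaces.
Variables (k : finFieldType) (n : nat).
Local Notation q := #|k|.

Definition W_generators : set (kx0 k) :=
  [set p : kx0 k | kx0_val p = 'X + 'X^(q ^ n) \/ kx0_val p = 'X^(q ^ n + 1)].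

Definition W_space : set (kx0 k) := smallest (@T_space k) W_generators.

(* Integers i, j with i > j >= 0 are natural numbers. *)
Definition Y_monomials : set (kx0 k) :=
  [set p : kx0 k | exists i j : nat,
    (j < i < q ^ n)%N /\ kx0_val p = 'X^(i + q ^ n * j)].

End TheSpaces.

Arguments W_generators k n : clear implicits.
Arguments W_space k n : clear implicits.
Arguments Y_monomials k n : clear implicits.

(* Main.v *)
Require Import Defs.
From mathcomp Require Import all_boot all_algebra finfield pgroup abelian.
From mathcomp Require Import ring zify.
From mathcomp Require Import mathcomp_extra boolp classical_sets functions cardinality.

(** Write [Q = q^n]. The map [sigma : f(x) |-> f(x^Q)] is [f |-> f^Q], because
    [k] has [q] elements. Modulo [x^(Q^2) - x] it is an involution exchanging
    [x^(i + Q j)] and [x^(j + Q i)] for [i, j < Q]. The [f] with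
    [f = sigma f] modulo [x^(Q^2) - x] form a T-space containing the two
    generators, hence containing [W_n]. For [f] in [Y_n], the support of [f]
    and its image under the digit swap are disjoint, so [f] in [Y_n] and [W_n]
    forces [f = 0]. Conversely [W_n] contains every [x^(i + Q i)] and, by
    polarization, every [x^(i + Q j) + x^(j + Q i)]; so modulo [W_n] a monomial
    [x^(i + Q j)] with [i < Q] lies in [Y_n] if [j < i], vanishes if [j = i],
    and is minus a monomial of smaller degree if [j > i]. *)

Set Implicit Arguments.
Unset Strict Implicit.
Unset Printing Implicit Defensive.

Import GRing.Theory.

Local Open Scope classical_set_scope.
Local Open Scope card_scope.
Local Open Scope ring_scope.

(** * Closure properties of subspaces, spans and sums of subspaces *)

Section Subspaces.
Variables (k : fieldType) (V : lmodType k).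
Implicit Types B Y W : set V.

Lemma subspaceE Y :
  subspace Y <-> Y 0 /\ forall a u v, Y u -> Y v -> Y (a *: u + v).
Proof.
split=> -[Y0 YD]; split.
- by move: Y0; rewrite inE.
- by move=> a u v Yu Yv; have := YD a u v; rewrite !inE; apply.
- by rewrite inE.
- by move=> a u v; rewrite !inE; apply: YD.
Qed.

Lemma subspaceD Y u v : subspace Y -> Y u -> Y v -> Y (u + v).
Proof. by move=> /subspaceE[_ YD] Yu; move/(YD 1 u v Yu); rewrite scale1r. Qed.

Lemma subspaceZ Y a u : subspace Y -> Y u -> Y (a *: u).
Proof. by move=> /subspaceE[Y0 YD] /(YD a) /(_ Y0); rewrite addr0. Qed.

Lemma subspaceB Y u v : subspace Y -> Y u -> Y v -> Y (u - v).
Proof.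
by move=> sY Yu Yv; rewrite -scaleN1r; apply: subspaceD => //; apply: subspaceZ.
Qed.

Lemma subspace_sum Y (I : Type) (r : seq I) (P : pred I) (F : I -> V) :
  subspace Y -> (forall i, P i -> Y (F i)) -> Y (\sum_(i <- r | P i) F i).
Proof.
move=> sY YF; apply: big_ind => //; first by have /subspaceE[] := sY.
by move=> u v; apply: subspaceD.
Qed.

Lemma subspace_lin_span B : subspace (lin_span B).
Proof.
apply/subspaceE; split=> [S [/subspaceE[]//]|a u v Bu Bv S SB].
by have [/subspaceE[_ SD] _] := SB; apply: SD; [apply: Bu|apply: Bv].
Qed.

Lemma subspace_sumset Y W :
  subspace Y -> subspace W -> subspace [set y + w | y in Y & w in W].
Proof.
move=> /subspaceE[Y0 YD] /subspaceE[W0 WD]; apply/subspaceE; split.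
  by exists 0 => //; exists 0 => //; rewrite addr0.
move=> a _ _ [y Yy [w Ww <-]] [y' Yy' [w' Ww' <-]].
exists (a *: y + y'); first exact: YD.
by exists (a *: w + w'); [exact: WD|rewrite scalerDr addrACA].
Qed.

End Subspaces.

(** * Monomials and endomorphisms of k[x]_0 *)

Section NonunitalPolynomials.
Variable k : fieldType.
Implicit Types (f g p : kx0 k) (S : set (kx0 k)).

(* The zero element when m = 0, since 1 is not in k[x]_0. *)
Definition kx0_Xn (m : nat) : kx0 k := insubd 0 'X^m.

Lemma kx0_XnE m : (0 < m)%N -> kx0_val (kx0_Xn m) = 'X^m.
Proof.
by move=> m_gt0; rewrite insubdK// inE coefXn (ltn_eqF m_gt0).
Qed.

Lemma kx0_coef0 p : (kx0_val p)`_0 = 0.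
Proof. by have := valP p; rewrite inE => /eqP. Qed.

Fact kx0_comp_subproof f p : kx0_val f \Po kx0_val p \in @zero_const k.
Proof.
by rewrite inE -horner_coef0 horner_comp !horner_coef0 kx0_coef0
           horner_coef0 kx0_coef0.
Qed.

Definition kx0_comp f p : kx0 k := Kx0 (kx0_comp_subproof f p).

Lemma kx0_comp_endomorphism p : kx0_endomorphism (kx0_comp^~ p).
Proof.
split=> [a f g|f g]; apply: val_inj; rewrite /= ?linearP//.
by rewrite rmorphM.
Qed.

(** Since x generates k[x]_0, an endomorphism is substitution of the image of x; invariance thus
    reduces to closure under substitution. *)
Lemma kx0_endomorphismE phi f :
  kx0_endomorphism phi -> phi f = kx0_comp f (phi (kx0_Xn 1)).
Proof.
move=> [phi_lin phiM]; pose x := kx0_Xn 1.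
have xE : kx0_val x = 'X by rewrite kx0_XnE ?expr1.
(* The induction runs over g with f = g x: stripping coefficients from f itself would leave
   k[x]_0. *)
have mulX_in (g : {poly k}) : g * 'X \in @zero_const k.
  by rewrite inE coefMX.
have phiE (g : {poly k}) :
    kx0_val (phi (Kx0 (mulX_in g))) = (g * 'X) \Po kx0_val (phi x).
  elim/poly_ind: g => [|g c IHg].
    have -> : Kx0 (mulX_in 0) = 0 by apply: val_inj; rewrite /= mul0r.
    have := phi_lin (-1) 0 0; rewrite scaler0 addr0 scaleN1r addNr => ->.
    by rewrite mul0r comp_poly0.
  have -> : Kx0 (mulX_in (g * 'X + c%:P)) =
            c *: x + kx0_mul (Kx0 (mulX_in g)) x.
    by apply: val_inj; rewrite /= xE mulrDl mul_polyC addrC.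
  rewrite phi_lin phiM /= IHg.
  rewrite mulrDl comp_polyD !comp_polyM comp_polyX comp_polyC mul_polyC.
  exact: addrC.
have -> : f = Kx0 (mulX_in (\poly_(i < size (kx0_val f)) (kx0_val f)`_i.+1)).
  apply: val_inj; apply/polyP=> -[|i] /=; rewrite coefMX ?kx0_coef0//=.
  rewrite coef_poly; case: ltnP => // le_f_i.
  by rewrite nth_default// leqW.
by apply: val_inj; exact: phiE.
Qed.

Lemma subspace_kx0_full S :
  subspace S -> (forall m, (0 < m)%N -> S (kx0_Xn m)) -> forall p, S p.
Proof.
move=> sS SX p.
have -> : p = \sum_(i < size (kx0_val p) | (0 < i)%N)
                 (kx0_val p)`_i *: kx0_Xn i.
  apply: val_inj; rewrite raddf_sum /= -[LHS]coefK poly_def.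
  rewrite big_mkcond [RHS]big_mkcond /=.
  apply: eq_bigr => -[i lti] _ /=; case: posnP => [->|i_gt0].
    by rewrite kx0_coef0 scale0r.
  by rewrite kx0_XnE.
by apply: subspace_sum => // i i_gt0; apply: subspaceZ => //; apply: SX.
Qed.

End NonunitalPolynomials.

Arguments kx0_Xn {k} m.

Lemma dvdp_sub_comp (k : fieldType) (p a b : {poly k}) :
  a - b %| (p \Po a) - (p \Po b).
Proof.
elim/poly_ind: p => [|p c IHp]; first by rewrite !comp_poly0 subr0 dvdp0.
rewrite !comp_poly_MXaddC opprD addrACA subrr addr0.
have -> : (p \Po a) * a - (p \Po b) * b =
          ((p \Po a) - (p \Po b)) * a + (p \Po b) * (a - b).
  by rewrite mulrBl mulrBr addrA subrK.
by apply: dvdp_add; [apply: dvdp_mulr|apply: dvdp_mull].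
Qed.

(** * The Q-th power map on k[x] *)

Section Frobenius.
Variables (k : finFieldType) (n : nat).
Local Notation Q := (#|k| ^ n)%N.

Lemma pchar_nat_card : [pchar k].-nat #|k|.
Proof.
have [p p_pr charkp] := finPcharP k.
have /abelem_pgroup := fin_ring_pchar_abelem charkp.
rewrite /pgroup cardsT; apply: sub_in_pnat => r _ /eqP->.
exact: charkp.
Qed.

(** Q is a power of the characteristic, so the Q-th power is additive; it fixes each coefficient
    because c^q = c in k. *)
Lemma exp_card_poly (p : {poly k}) : p ^+ Q = p \Po 'X^Q.
Proof.
elim/poly_ind: p => [|p c IHp].
  by rewrite comp_poly0 expr0n gtn_eqF// expn_gt0 (ltnW (finNzRing_gt1 k)).
rewrite comp_poly_MXaddC -IHp exprDn_pchar; last first.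
  by rewrite pnatX (eq_pnat _ (pchar_poly k)) pchar_nat_card.
rewrite exprMn -rmorphXn /=; congr (_ + _%:P).
by elim: n => [|m IHm]; rewrite ?expr1// expnSr exprM IHm expf_card.
Qed.

Lemma polar_norm_card_poly (a b : {poly k}) :
  (a + b) ^+ (Q + 1) - (a ^+ (Q + 1) + b ^+ (Q + 1)) = a * b ^+ Q + b * a ^+ Q.
Proof.
have : (a + b) ^+ Q = a ^+ Q + b ^+ Q.
  rewrite (exp_card_poly a) (exp_card_poly b) (exp_card_poly (a + b)).
  by rewrite comp_polyD.
move: Q => N abN; rewrite [(a + b) ^+ _]exprD abN expr1.
by rewrite !exprD !expr1; ring.
Qed.

End Frobenius.

(** * Base-N digits of exponents *)

Section Digits.
Variable N : nat.

(** A genuine digit swap only for m < N^2; beyond that [m %/ N] is no longer a single digit. *)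
Definition swap_digits m := (m %/ N + N * (m %% N))%N.

Lemma divn_digits i j : (i < N)%N -> ((i + N * j) %/ N)%N = j.
Proof.
move=> ltiN; have N_gt0 := leq_ltn_trans (leq0n i) ltiN.
by rewrite mulnC divnDMl// divn_small.
Qed.

Lemma modn_digits i j : (i < N)%N -> ((i + N * j) %% N)%N = i.
Proof. by move=> ltiN; rewrite mulnC addnC modnMDl modn_small. Qed.

Lemma ltn_digits i j : (i < N)%N -> (j < N)%N -> (i + N * j < N * N)%N.
Proof.
move=> ltiN ltjN; have N_gt0 := leq_ltn_trans (leq0n i) ltiN.
apply: (@leq_trans (N * j.+1)); last by rewrite leq_mul2l ltjN orbT.
by rewrite mulnS ltn_add2r.
Qed.

Lemma digitsE m : m = (m %% N + N * (m %/ N))%N.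
Proof. by rewrite mulnC addnC -divn_eq. Qed.

End Digits.

(** * The substitution of x^N modulo x^(N^2) - x *)

Section DigitSwap.
Variables (k : fieldType) (N : nat).
Hypothesis N_gt1 : (1 < N)%N.
Local Notation D := ('X^(N * N) - 'X : {poly k}).
Implicit Type f : {poly k}.

Let N_gt0 : (0 < N)%N. Proof. exact: ltnW. Qed.

(** With m = r + N d, the exponent N m is N r + N^2 d, and x^(N^2 d) reduces to x^d. No bound on m
    is involved. *)
Lemma dvdp_swap_digits m : D %| 'X^(N * m) - 'X^(swap_digits N m).
Proof.
rewrite {1}(digitsE N m) mulnDr mulnA /swap_digits addnC !exprD -mulrBl.
apply: dvdp_mulr.
have := dvdp_sub_comp ('X^(m %/ N)) 'X^(N * N) ('X : {poly k}).
by rewrite !comp_Xn_poly -exprM.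
Qed.

Lemma eq0_of_dvdp_sub_comp_Xn f :
    (forall m, f`_m != 0 -> (m %/ N < m %% N)%N) ->
  D %| f - (f \Po 'X^N) -> f = 0.
Proof.
move=> suppf Df.
have size_f : (size f <= N * N)%N.
  (* If m >= N^2, the quotient is at least N and so exceeds the remainder. *)
  apply/leq_sizeP => m le_m; apply/eqP/contraT => /suppf; rewrite ltnNge.
  by rewrite (leq_trans (ltnW (ltn_pmod _ N_gt0))) ?leq_divRL.
have fE : f = \sum_(m < N * N) f`_m *: 'X^m.
  rewrite -poly_def; apply/polyP => m; rewrite coef_poly; case: ltnP => // le_m.
  by rewrite nth_default// (leq_trans size_f).
pose g := \sum_(m < N * N) f`_m *: 'X^(swap_digits N m).
have Dg : D %| (f \Po 'X^N) - g.
  rewrite {1}fE raddf_sum -sumrB; apply: (big_ind (fun h => D %| h)) => [||m _].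
  - exact: dvdp0.
  - by move=> h1 h2; apply: dvdp_add.
  rewrite /= comp_polyZ comp_Xn_poly -exprM -scalerBr -mul_polyC.
  by apply: dvdp_mull; apply: dvdp_swap_digits.
have size_D : size D = (N * N).+1.
  rewrite size_polyDl size_polyXn// size_polyN size_polyX ltnS.
  exact: ltn_mul N_gt1 N_gt1.
(* Both f and g have degree below N^2, the degree of D, so their congruence modulo D is an
   equality. *)
have /eqP : f - g == 0.
  have Dfg : D %| f - g.
    by rewrite -[f](subrK (f \Po 'X^N)) -addrA; apply: dvdp_add.
  rewrite -size_poly_eq0 -leqn0 leqNgt; apply/negP => fg_gt0.
  have := dvdp_leq _ Dfg; rewrite size_D -size_poly_gt0 fg_gt0 => /(_ isT).
  rewrite ltnNge (leq_trans (size_polyD _ _))// geq_max size_f size_polyN /=.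
  apply: (leq_trans (size_sum _ _ _)); apply/bigmax_leqP => -[m ltm] _ /=.
  apply: (leq_trans (size_scale_leq _ _)); rewrite size_polyXn /swap_digits.
  by apply: ltn_digits; rewrite ?ltn_mod// ltn_divLR.
move/subr0_eq => fg; apply/polyP => m; rewrite coef0.
(* A common exponent m of f and g would be the swap of some m' in the support of f, reversing the
   strict inequality between its digits. *)
have [//|/suppf lt_m] := eqVneq f`_m 0.
rewrite fg coef_sum big1// => -[m' ltm'] _ /=; rewrite coefZ coefXn.
have [->|/suppf lt_m'] := eqVneq f`_m' 0; first by rewrite mul0r.
have [mE|_] := eqVneq m; last by rewrite mulr0.
have lt_m'N : (m' %/ N < N)%N by rewrite ltn_divLR.
move: lt_m; rewrite mE /swap_digits divn_digits// modn_digits//.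
by rewrite ltnNge ltnW.
Qed.

End DigitSwap.

(** * Elements of W_n, its invariant, and the complement *)

Section Complement.
Variables (k : finFieldType) (n : nat).
Hypothesis n_gt0 : (1 <= n)%N.
Local Notation Q := (#|k| ^ n)%N.
Local Notation W := (W_space k n).

Let Q_gt1 : (1 < Q)%N.
Proof. by rewrite -(exp1n n) ltn_exp2r// finNzRing_gt1. Qed.

Let Q_gt0 : (0 < Q)%N. Proof. exact: ltnW. Qed.

Lemma T_space_W : T_space W.
Proof.
split=> [|phi phi_endo p Wp S SG]; last first.
  by have [[_ Sphi] _] := SG; apply: Sphi => //; apply: Wp.
apply/subspaceE; split=> [S [[/subspaceE[]//]]|a u v Wu Wv S SG].
by have [[/subspaceE[_ SD] _] _] := SG; apply: SD; [apply: Wu|apply: Wv].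
Qed.

Let subW : subspace W. Proof. by case: T_space_W. Qed.

Lemma W_space_comp (f p : kx0 k) : W f -> W (kx0_comp f p).
Proof.
by have [_ Wphi] := T_space_W; apply: Wphi (kx0_comp_endomorphism p) _.
Qed.

(** Substitution of p in the first generator. The hypothesis lives in [{poly k}], where powers are
    available. *)
Lemma W_space_frobenius (p f : kx0 k) :
  kx0_val f = kx0_val p + kx0_val p ^+ Q -> W f.
Proof.
move=> fE.
have [g gE] : exists g : kx0 k, kx0_val g = 'X + 'X^Q.
  by exists (kx0_Xn 1 + kx0_Xn Q); rewrite /= !kx0_XnE ?expr1.
have -> : f = kx0_comp g p.
  by apply: val_inj; rewrite /= fE gE comp_polyD comp_polyX comp_Xn_poly.
apply: W_space_comp.
by apply: sub_gen_smallest; left.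
Qed.

Lemma W_space_norm (p f : kx0 k) :
  kx0_val f = kx0_val p ^+ (Q + 1) -> W f.
Proof.
move=> fE; have -> : f = kx0_comp (kx0_Xn (Q + 1)) p.
  by apply: val_inj; rewrite /= fE kx0_XnE ?addn1// comp_Xn_poly.
apply: W_space_comp.
by apply: sub_gen_smallest; right; rewrite kx0_XnE ?addn1.
Qed.

Lemma W_space_swap i j : (0 < i + j)%N ->
  W (kx0_Xn (i + Q * j) + kx0_Xn (j + Q * i)).
Proof.
wlog le_ji : i j / (j <= i)%N.
  move=> wlg; have [|/ltnW] := leqP j i; first exact: wlg.
  by move=> le_ij ij_gt0; rewrite addrC; apply: wlg; rewrite // addnC.
case: j le_ji => [|j] le_ji ij_gt0.
  (* Polarization would need x^0, which is not in k[x]_0; the first generator at x^i serves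
     instead. *)
  rewrite muln0 addn0 in ij_gt0 *; rewrite add0n.
  apply: (@W_space_frobenius (kx0_Xn i)).
  by rewrite /= !kx0_XnE ?muln_gt0 ?Q_gt0// -exprM mulnC.
have i_gt0 : (0 < i)%N by apply: leq_trans le_ji.
set j' := j.+1; have j_gt0 : (0 < j')%N by [].
pose normX (p : kx0 k) : kx0 k := kx0_comp (kx0_Xn (Q + 1)) p.
have Wnorm p : W (normX p).
  by apply: (@W_space_norm p); rewrite /= kx0_XnE ?addn1// comp_Xn_poly.
have -> : kx0_Xn (i + Q * j') + kx0_Xn (j' + Q * i) =
    normX (kx0_Xn i + kx0_Xn j') - (normX (kx0_Xn i) + normX (kx0_Xn j')).
  apply: val_inj; rewrite /= (@kx0_XnE _ (Q + 1)) ?addn1// -addn1.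
  rewrite !kx0_XnE ?addn_gt0 ?i_gt0 ?j_gt0//.
  rewrite !comp_Xn_poly polar_norm_card_poly -!exprM -!exprD.
  by rewrite ![(_ * Q)%N]mulnC.
by apply: (subspaceB subW) => //; apply: (subspaceD subW).
Qed.

(** In characteristic 2 the case i = j of [W_space_swap] only gives 0, so the second generator is
    evaluated at x^i. *)
Lemma W_space_diag i : (0 < i)%N -> W (kx0_Xn (i + Q * i)).
Proof.
move=> i_gt0; apply: (@W_space_norm (kx0_Xn i)).
by rewrite !kx0_XnE ?addn_gt0 ?i_gt0// -exprM addn1 mulnSr mulnC addnC.
Qed.

(** As f(x^Q) = f^Q, these are the f that map the field of Q^2 elements into its subfield of Q
    elements, as the trace x + x^Q and the norm x^(Q+1) do. *)
Definition twisted_kernel : set (kx0 k) :=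
  [set f : kx0 k | 'X^(Q * Q) - 'X %| kx0_val f - (kx0_val f \Po 'X^Q)].

Lemma T_space_twisted_kernel : T_space twisted_kernel.
Proof.
split.
  apply/subspaceE; split=> [|a u v Ku Kv]; rewrite /twisted_kernel /=.
    by rewrite comp_poly0 subr0 dvdp0.
  rewrite comp_polyD comp_polyZ opprD addrACA -scalerBr -mul_polyC.
  by apply: dvdp_add => //; apply: dvdp_mull.
move=> phi phi_endo f; rewrite (kx0_endomorphismE _ phi_endo).
move: (phi _) => p; rewrite /twisted_kernel /=.
set F := kx0_val f; set P := kx0_val p => DF.
(* Both sides are F(P^Q), because P(x^Q) = P^Q. *)
have -> : (F \Po P) \Po 'X^Q = (F \Po 'X^Q) \Po P.
  by rewrite -!comp_polyA -exp_card_poly comp_Xn_poly.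
have [G GE] := dvdpP _ _ DF; rewrite -rmorphB /= GE rmorphM /=.
(* Substituting P in x^(Q^2) - x gives P^(Q^2) - P = P(x^(Q^2)) - P(x), a multiple of x^(Q^2) -
   x. *)
apply: dvdp_mull; rewrite rmorphB /= comp_polyX comp_Xn_poly [P ^+ _]exprM.
rewrite (exp_card_poly n P) (exp_card_poly n (P \Po _)).
rewrite -comp_polyA comp_Xn_poly -exprM.
by have := dvdp_sub_comp P 'X^(Q * Q) 'X; rewrite comp_polyXr.
Qed.

(** On the generators, f - f(x^Q) is x - x^(Q^2) and x^Q (x - x^(Q^2)) respectively. *)
Lemma sub_W_space_twisted_kernel : W `<=` twisted_kernel.
Proof.
apply: smallest_sub; first exact: T_space_twisted_kernel.
move=> f [] fE; rewrite /twisted_kernel /= fE.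
  rewrite comp_polyD comp_polyX comp_Xn_poly -exprM opprD.
  by rewrite addrA addrK -dvdpNr opprB.
rewrite comp_Xn_poly -exprM mulnDr muln1 addnC !exprD expr1.
rewrite -mulrBl; apply: dvdp_mulr.
by rewrite -dvdpNr opprB.
Qed.

Lemma Y_monomialsE p : Y_monomials k n p ->
  exists2 m, p = kx0_Xn m & (m %/ Q < m %% Q)%N /\ (0 < m)%N.
Proof.
move=> [i [j [/andP[ltji ltiQ] pE]]].
have m_gt0 : (0 < i + Q * j)%N by rewrite addn_gt0 (leq_ltn_trans _ ltji).
exists (i + Q * j)%N; first by apply: val_inj; rewrite /= pE kx0_XnE.
by rewrite divn_digits// modn_digits.
Qed.

Lemma coef_kx0_Xn m m' : (0 < m)%N ->
  (kx0_val (kx0_Xn m : kx0 k))`_m' = (m' == m)%:R.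
Proof. by move=> m_gt0; rewrite kx0_XnE// coefXn. Qed.

Lemma lin_indep_Y_monomials : lin_indep (Y_monomials k n).
Proof.
move=> s c s_uniq sub_s sum0 v vs.
have [m vE [_ m_gt0]] := Y_monomialsE (sub_s _ vs).
have := congr1 val sum0; rewrite raddf_sum => /(congr1 (coefp m)).
rewrite raddf_sum /= coef0 (bigD1_seq v)//= coefZ {2}vE coef_kx0_Xn// eqxx.
rewrite mulr1 big1_seq ?addr0// => u /andP[u_neq_v us].
have [m' uE [_ m'_gt0]] := Y_monomialsE (sub_s _ us).
rewrite coefZ uE coef_kx0_Xn//.
case: eqVneq => [mE|]; last by rewrite mulr0.
by rewrite uE vE mE eqxx in u_neq_v.
Qed.

(** The support condition cuts out a subspace that contains the spanning monomials. *)
Lemma coef_lin_span_Y p m : lin_span (Y_monomials k n) p ->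
  (kx0_val p)`_m != 0 -> (m %/ Q < m %% Q)%N.
Proof.
pose S := [set p : kx0 k |
  forall m, (kx0_val p)`_m != 0 -> (m %/ Q < m %% Q)%N].
suff /[apply] : lin_span (Y_monomials k n) `<=` S by apply.
apply: smallest_sub => [|f /Y_monomialsE[m' -> [lt_m' m'_gt0]]].
  apply/subspaceE; split=> [m'|a u v Su Sv m']; first by rewrite coef0 eqxx.
  rewrite /= coefD coefZ.
  have [->|/Su//] := eqVneq (kx0_val u)`_m' 0.
  by rewrite mulr0 add0r => /Sv.
move=> m''; rewrite coef_kx0_Xn//; have [-> //|_] := eqVneq m'' m'.
by rewrite eqxx.
Qed.

Lemma Y_monomials_direct_sum : is_direct_sum (lin_span (Y_monomials k n)) W.
Proof.
set Y := lin_span _; have sY : subspace Y by exact: subspace_lin_span.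
have [/subspaceE[Y0 _] /subspaceE[W0 _]] := (sY, subW).
have sYW := subspace_sumset sY subW.
split=> //; apply/seteqP; split=> // p; last first.
- by move=> ->.
- move=> [Yp /sub_W_space_twisted_kernel Kp]; apply: val_inj => /=.
  by apply: (eq0_of_dvdp_sub_comp_Xn Q_gt1) => // m; apply: coef_lin_span_Y.
move=> _; move: p; apply: (subspace_kx0_full sYW).
elim/ltn_ind=> m IHm m_gt0.
have lt_mQ : (m %% Q < Q)%N by rewrite ltn_mod.
have swap_gt0 : (0 < m %% Q + m %/ Q)%N.
  move: m_gt0; rewrite {1}(digitsE Q m) !addn_gt0 muln_gt0.
  by case/orP=> [->//|/andP[_ ->]]; rewrite orbT.
have [lt_m|lt_m|eq_m] := ltngtP (m %/ Q) (m %% Q).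
- exists (kx0_Xn m); last by exists 0; rewrite ?addr0.
  apply: sub_gen_smallest; exists (m %% Q)%N, (m %/ Q)%N; rewrite lt_m lt_mQ.
  by rewrite kx0_XnE// -digitsE.
(* This case includes every m >= Q^2. The descent works since m - m' = (Q - 1) (m %/ Q - m %% Q) >
   0. *)
- set m' := (m %/ Q + Q * (m %% Q))%N.
  have -> : kx0_Xn m =
      kx0_Xn (m %% Q + Q * (m %/ Q)) + kx0_Xn m' - kx0_Xn m' :> kx0 k.
    by rewrite addrK -digitsE.
  apply: (subspaceB sYW).
    by exists 0 => //; eexists; [exact: W_space_swap swap_gt0|rewrite add0r].
  apply: IHm; last by rewrite addn_gt0 (leq_ltn_trans _ lt_m).
  by rewrite [X in (_ < X)%N](digitsE Q m); nia.
- exists 0 => //; exists (kx0_Xn m); rewrite ?add0r//.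
  rewrite (digitsE Q m) eq_m; apply: W_space_diag.
  by move: swap_gt0; rewrite eq_m addnn double_gt0.
Qed.

(** Each i < Q admits i values of j, and the sum of these i is the binomial coefficient; the
    exponent determines its digits, so nothing is counted twice. *)
Lemma card_Y_monomials : Y_monomials k n #= `I_('C(Q, 2)).
Proof.
pose s := [seq (i + Q * j)%N | i <- iota 0 Q, j <- iota 0 i].
have size_s : size s = 'C(Q, 2).
  rewrite size_allpairs_dep -bin2_sum sumnE big_map /index_iota subn0.
  by apply: eq_bigr => i _; rewrite size_iota.
have sP m : reflect (exists i j : nat, (j < i < Q)%N /\ m = (i + Q * j)%N)
                    (m \in s).
  apply: (iffP allpairsPdep) => [[i [j []]]|[i [j [/andP[ltji ltiQ] ->]]]].
    by rewrite !mem_iota /= !add0n => ltiQ ltji ->; exists i, j; rewrite ltji.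
  by exists i, j; rewrite !mem_iota.
have uniq_s : uniq s.
  apply: allpairs_uniq_dep => [|i _|]; rewrite ?iota_uniq//.
  move=> _ _ /allpairsPdep[i [j [+ + ->]]] /allpairsPdep[i' [j' [+ + ->]]] /=.
  rewrite !mem_iota /= !add0n => ltiQ ltji lti'Q ltj'i' eq_m.
  have := congr1 (divn^~ Q) eq_m; have := congr1 (modn^~ Q) eq_m.
  by rewrite !divn_digits// !modn_digits// => -> ->.
have -> : Y_monomials k n = [set kx0_Xn (nth 0%N s t) | t in `I_('C(Q, 2))].
  rewrite -size_s; apply/seteqP; split=> p.
    move=> [i [j [ij pE]]].
    have ms : (i + Q * j)%N \in s by apply/sP; exists i, j.
    exists (index (i + Q * j)%N s); first by rewrite /= index_mem.
    apply: val_inj; rewrite nth_index//= pE kx0_XnE// addn_gt0.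
    by case/andP: ij => /(leq_ltn_trans (leq0n _))->.
  move=> [t /= /(mem_nth 0%N)/sP[i [j [ij ->]]] <-]; exists i, j; split=> //.
  rewrite kx0_XnE// addn_gt0; case/andP: ij => ltji _.
  by rewrite (leq_ltn_trans _ ltji).
apply: inj_card_eq => t t'; rewrite !inE /= -size_s => lt_t lt_t' eq_p.
have nth_gt0 u : (u < size s)%N -> (0 < nth 0%N s u)%N.
  move=> /(mem_nth 0%N)/sP[i [j [/andP[ij _] ->]]].
  by rewrite addn_gt0 (leq_ltn_trans _ ij).
(* Equal monomials have equal exponents, read off from one coefficient; [uniq_s] then gives t =
   t'. *)
have /eqP := congr1 (fun p : kx0 k => (kx0_val p)`_(nth 0%N s t)) eq_p.
rewrite !coef_kx0_Xn ?nth_gt0// eqxx.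
have [/eqP|_] := eqVneq (nth 0%N s t) (nth 0%N s t'); last by rewrite oner_eq0.
by rewrite nth_uniq// => /eqP.
Qed.

End Complement.

Theorem mainTheorem4 (k : finFieldType) (n : nat) (hn : (1 <= n)%N) :
  Y_monomials k n #= `I_('C(#|k| ^ n, 2)) /\
  exists Y : set (kx0 k),
    [/\ subspace Y, is_basis (Y_monomials k n) Y & is_direct_sum Y (W_space k n)].
Proof.
split; first exact: card_Y_monomials.
exists (lin_span (Y_monomials k n)); split.
- exact: subspace_lin_span.
- by split=> //; apply: lin_indep_Y_monomials.
- exact: Y_monomials_direct_sum.
Qed.
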